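(* Let $M$ be a connected smooth one-dimensional manifold with local coordinate $y$, and consider the equation $$\frac{\partial y}{\partial t}=A\Big(\frac{\partial^2y}{\partial x^2}+\Gamma\,\frac{\partial y}{\partial x}\frac{\partial y}{\partial x}\Big),$$ where $A=A(y)$ (nowhere zero) is the component of a smooth operator field and $\Gamma=\Gamma(y)$ the component of a smooth affine connection on $M$. If the algebra $\mathcal G$ of point symmetries of this equation has the maximal dimension $\dim\mathcal G=2$, then (near every point of $M$) there exists a point transformation $\tilde y=\tilde y(y)$ bringing the equation to the form (tilde omitted) $$\frac{\partial y}{\partial t}=a\,\frac{\partial^2y}{\partial x^2},\qquad a=\mathrm{const}.$$
   Context: Under a change of coordinate $\tilde y=\tilde y(y)$, $A$ is unchanged as a function on $M$ (a $(1,1)$ tensor in dimension one) and $\Gamma$ transforms as an affine connection. A vector field $\boldsymbol\eta=\eta(y)\,\partial/\partial y$ on $M$ is a point symmetry if its local flow carries solutions to solutions ($x,t$ unchanged); this is expressed by the determining equations (to be used as the definition, for $A\ne0$): $\eta A'=0$ and $\eta'\,\Gamma=\eta''+\Gamma'\eta+2\Gamma\eta'$. $\mathcal G$ is the real Lie algebra of all point symmetries on $M$; its dimension never exceeds $2$. *)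

(* Defs.v *)
From HB Require Import structures.
From mathcomp Require Import all_boot all_order all_algebra.
From mathcomp Require Import all_classical all_reals all_analysis.

Set Implicit Arguments.
Unset Strict Implicit.
Unset Printing Implicit Defensive.

Import Order.TTheory GRing.Theory Num.Theory.
Import numFieldNormedType.Exports.

Local Open Scope classical_set_scope.
Local Open Scope ring_scope.

(* In ring_scope this notation otherwise denotes the derivative of a polynomial. *)
Local Notation "f ^` ()" := (derive1 f) : ring_scope.

(* Meaningful for open U, on which the iterated derivatives only depend on the
   values of f on U. *)
Definition smooth_on (R : realType) (U : set R) (f : R -> R) : Prop :=
  forall (n : nat) (y : R), U y -> derivable (derive1n n f) y 1.

Definition diffeo_on (R : realType) (W : set R) (f : R -> R) : Prop :=
  [/\ open W, open (f @` W), smooth_on W f &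
      exists2 g : R -> R, smooth_on (f @` W) g & forall y, W y -> g (f y) = y].

(* The values of mcoord i outside mdom i, and of minv i outside the image
   of mdom i, are irrelevant. *)
Record manifold1 (R : realType) := Manifold1 {
  mpoint : topologicalType;
  mindex : Type;
  mdom : mindex -> set mpoint;
  mcoord : mindex -> mpoint -> R;
  minv : mindex -> R -> mpoint;
  m_hausdorff : hausdorff_space mpoint;
  m_second_countable : @second_countable mpoint;
  m_cover : forall p : mpoint, exists i, mdom i p;
  m_dom_open : forall i, open (mdom i);
  m_image_open : forall i, open (mcoord i @` mdom i);
  m_coordK : forall i p, mdom i p -> minv i (mcoord i p) = p;
  m_coord_continuous : forall i, {within mdom i, continuous (mcoord i)};
  m_inv_continuous : forall i,
    {within mcoord i @` mdom i, continuous (minv i)};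
  m_compatible : forall i j,
    smooth_on (mcoord i @` (mdom i `&` mdom j)) (mcoord j \o minv i)
}.

Definition chart_image (R : realType) (M : manifold1 R) (i : mindex M) : set R :=
  mcoord i @` mdom i.

Definition transition (R : realType) (M : manifold1 R) (i j : mindex M) :
  R -> R := mcoord j \o minv i.

(* A field of (1,1) tensors has a single component, which is a scalar. *)
Definition operator_component (R : realType) (M : manifold1 R)
  (A : mpoint M -> R) (i : mindex M) : R -> R := A \o minv i.

Definition smooth_operator_field (R : realType) (M : manifold1 R)
  (A : mpoint M -> R) : Prop :=
  forall i : mindex M, smooth_on (chart_image i) (operator_component A i).

(* Change of coordinate y~ = f y, with Gam and Gam' the components of one and
   the same connection in the coordinates y and y~. *)
Definition connection_law (R : realType) (f Gam Gam' : R -> R) (y : R) : Prop :=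
  Gam y = Gam' (f y) * f^`() y + f^`()^`() y / f^`() y.

Definition affine_connection (R : realType) (M : manifold1 R)
  (Gam : mindex M -> R -> R) : Prop :=
  (forall i, smooth_on (chart_image i) (Gam i)) /\
  (forall i j p, mdom i p -> mdom j p ->
     connection_law (transition i j) (Gam i) (Gam j) (mcoord i p)).

(* A vector field is the family of its components in the charts of the atlas.
   Components are normalised to vanish outside the chart images, so that
   equality of families is equality of vector fields. *)
Definition vector_field (R : realType) (M : manifold1 R)
  (eta : mindex M -> R -> R^o) : Prop :=
  [/\ forall i, smooth_on (chart_image i) (eta i),
      forall i y, ~ chart_image i y -> eta i y = 0 &
      forall i j p, mdom i p -> mdom j p ->
        eta j (mcoord j p) =
        (transition i j)^`() (mcoord i p) * eta i (mcoord i p)].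

Definition determining_equations (R : realType) (A Gam eta : R -> R) (y : R) :
  Prop :=
  eta y * A^`() y = 0 /\
  eta^`() y * Gam y =
    eta^`()^`() y + Gam^`() y * eta y + 2 * Gam y * eta^`() y.

Definition point_symmetries (R : realType) (M : manifold1 R)
  (A : mpoint M -> R) (Gam : mindex M -> R -> R) : set (mindex M -> R -> R^o) :=
  [set eta | vector_field eta /\
     forall i y, chart_image i y ->
       determining_equations (operator_component A i) (Gam i) (eta i) y].

(* S is meant to be a linear subspace of V. *)
Definition has_dim (R : realType) (V : lmodType R) (S : set V) (n : nat) :
  Prop :=
  exists e : 'I_n -> V,
    [/\ forall k, S (e k),
        forall c : 'I_n -> R, \sum_(k < n) c k *: e k = 0 -> forall k, c k = 0 &
        forall v, S v -> exists c : 'I_n -> R, v = \sum_(k < n) c k *: e k].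

(* u x t is a classical solution on D of u_t = F(u, u_x, u_xx). *)
Definition solves (R : realType) (F : R -> R -> R -> R) (D : set (R * R))
  (u : R -> R -> R) : Prop :=
  forall x t : R, D (x, t) ->
    [/\ derivable (u x) t 1,
        derivable (u^~ t) x 1,
        derivable (u^~ t)^`() x 1 &
        (u x)^`() t = F (u x t) ((u^~ t)^`() x) ((u^~ t)^`()^`() x)].

(* The point transformation y~ = f y turns the solutions with values in W of the
   equation F into solutions of the equation F', and conversely. *)
Definition maps_solutions (R : realType) (W : set R) (f : R -> R)
  (F F' : R -> R -> R -> R) : Prop :=
  forall (D : set (R * R)) (u : R -> R -> R), open D ->
    (forall x t, D (x, t) -> W (u x t)) ->
    (solves F D u <-> solves F' D (fun x t => f (u x t))).

Definition evolution_rhs (R : realType) (A Gam : R -> R) (y yx yxx : R) : R :=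
  A y * (yxx + Gam y * yx * yx).

(* Main.v *)
(* If A' is nonzero at some point, the first determining equation makes every
   symmetry eta vanish near it. The second one says that the covariant
   derivative eta' + Gam eta is locally constant, so a symmetry vanishing near
   one point of a chart interval vanishes on that interval; hence the interior
   of the zero set of eta is open and closed, and eta = 0 by connectedness. As
   the symmetry algebra is nonzero, A' = 0 everywhere and A is locally constant.
   Near any point, an increasing solution f of f'' = Gam f' is then an affine
   coordinate of the connection, and the chain rule gives
   (f u)_xx = f'(u) (u_xx + Gam u_x^2). *)
Require Import Defs.
From HB Require Import structures.
From mathcomp Require Import all_boot all_order all_algebra.
From mathcomp Require Import all_classical all_reals all_analysis.
From mathcomp Require Import ring lra.
Import Order.TTheory GRing.Theory Num.Theory.
Import numFieldNormedType.Exports.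
Local Open Scope classical_set_scope.
Local Open Scope ring_scope.

(** * Smoothness on open sets, order by order *)

Fixpoint derivable_upto {R : realType} (U : set R) (n : nat) (f : R -> R) :
  Prop :=
  (forall y, U y -> derivable f y 1) /\
  if n is m.+1 then derivable_upto U m (derive1 f) else True.

(** [derivable_upto] peels off the innermost derivative first, so regularity of products, composites
    and inverses can be proved by induction on the order. *)
Lemma smooth_onP {R : realType} {U : set R} {f : R -> R} :
  smooth_on U f <-> forall n, derivable_upto U n f.
Proof.
split=> [sf n|sf n].
  elim: n f sf => [|n IHn] f sf /=; split=> //; try exact: (sf 0%N).
  by apply: IHn => k y Uy; rewrite -derive1Sn; exact: (sf k.+1).
elim: n f sf => [|n IHn] f sf y Uy; first exact: (sf 0%N).1.
rewrite derive1Sn; apply: IHn => // k; exact: (sf k.+1).2.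
Qed.

Section smooth_functions.
Context {R : realType}.
Implicit Types (U V : set R) (f g : R -> R).

Lemma derivable_is_derive1 [f : R -> R] [y : R] :
  derivable f y 1 -> is_derive y 1 f (derive1 f y).
Proof. by rewrite derive1E; exact: derivableP. Qed.

Lemma smooth_on_derive1 [U f y] : smooth_on U f -> U y ->
  is_derive y 1 f (derive1 f y).
Proof.
by move=> sf Uy; apply: derivable_is_derive1; exact: (sf 0%N).
Qed.

Lemma smooth_continuous [U f y] : smooth_on U f -> U y -> {for y, continuous f}.
Proof.
by move=> sf Uy; apply/differentiable_continuous/derivable1_diffP/(sf 0%N).
Qed.

Lemma smooth_on_derive2 [U f y] : smooth_on U f -> U y ->
  is_derive y 1 (derive1 f) (derive1 (derive1 f) y).
Proof.
move=> sf; apply: smooth_on_derive1 => n z Uz.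
by rewrite -derive1Sn; exact: (sf n.+1).
Qed.

(** The Leibniz and chain rules leave some factors undifferentiated; this lowers their order to that
    of the induction hypothesis. *)
Lemma derivable_uptoW [U n f] : derivable_upto U n.+1 f -> derivable_upto U n f.
Proof. by elim: n f => [|n IHn] f /= [? []]// ? ?; split => //; exact: IHn. Qed.

Lemma near_open_eq [U f g] : open U -> (forall y, U y -> f y = g y) ->
  forall y, U y -> \near y, f y = g y.
Proof.
move=> oU fg y Uy; apply: filterS fg _.
exact: open_nbhs_nbhs.
Qed.

Lemma derivable_upto_eq [U n f g] : open U -> (forall y, U y -> f y = g y) ->
  derivable_upto U n f -> derivable_upto U n g.
Proof.
move=> oU; elim: n f g => [|n IHn] f g fg /= [df df']; split=> //; last first.
  apply: IHn df' => y Uy; rewrite !derive1E; apply: near_eq_derive.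
  exact: near_open_eq Uy.
all: move=> y Uy; apply: near_eq_derivable (df _ Uy); exact: near_open_eq Uy.
Qed.

(** The inductive step of the closure lemmas: the derivative may be given by any formula [f'] valid
    on [U], because on an open set functions that agree have the same derivatives. *)
Lemma derivable_uptoS [U n f f'] : open U ->
  (forall y, U y -> is_derive y 1 f (f' y)) ->
  derivable_upto U n f' -> derivable_upto U n.+1 f.
Proof.
move=> oU ff' df'; split; first by move=> y /ff' [].
apply: derivable_upto_eq df' => // y /ff' Df.
by rewrite derive1E derive_val.
Qed.

Lemma derivable_upto_is_derive [U n f y] : derivable_upto U n f ->
  U y -> is_derive y 1 f (derive1 f y).
Proof.
move=> df Uy; apply: derivable_is_derive1.
by case: n df => [|n] [+ _]; exact.
Qed.

Lemma derivable_uptoD [U n f g] : open U ->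
  derivable_upto U n f -> derivable_upto U n g ->
  derivable_upto U n (f \+ g).
Proof.
move=> oU; elim: n f g => [|n IHn] f g df dg.
  split=> // y Uy; apply: derivableD; [exact: df.1|exact: dg.1].
apply: (@derivable_uptoS _ _ _ (derive1 f \+ derive1 g) oU).
  move=> y Uy; apply: is_deriveD.
    exact: derivable_upto_is_derive df Uy.
  exact: derivable_upto_is_derive dg Uy.
exact: IHn df.2 dg.2.
Qed.

Lemma derivable_uptoM [U n f g] : open U ->
  derivable_upto U n f -> derivable_upto U n g ->
  derivable_upto U n (f \* g).
Proof.
move=> oU; elim: n f g => [|n IHn] f g df dg.
  split=> // y Uy; apply: derivableM; [exact: df.1|exact: dg.1].
apply: (@derivable_uptoS _ _ _ ((f \* derive1 g) \+ (g \* derive1 f)) oU).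
  move=> y Uy; apply: is_deriveM.
    exact: derivable_upto_is_derive df Uy.
  exact: derivable_upto_is_derive dg Uy.
apply: derivable_uptoD oU _ _.
  exact: IHn (derivable_uptoW df) dg.2.
exact: IHn (derivable_uptoW dg) df.2.
Qed.

Lemma derivable_upto_comp [U V n f g] : open U ->
  (forall y, U y -> V (g y)) ->
  derivable_upto V n f -> derivable_upto U n g ->
  derivable_upto U n (f \o g).
Proof.
move=> oU gUV; elim: n f g gUV => [|n IHn] f g gUV df dg.
  split=> // y Uy.
  have Vgy := derivable_upto_is_derive df (gUV _ Uy).
  by have [] := is_derive1_comp Vgy (derivable_upto_is_derive dg Uy).
apply: (@derivable_uptoS _ _ _ ((derive1 f \o g) \* derive1 g) oU).
  move=> y Uy; apply: is_derive1_comp.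
    exact/(derivable_upto_is_derive df)/gUV.
  exact: derivable_upto_is_derive dg Uy.
apply: derivable_uptoM oU _ dg.2.
exact: IHn gUV df.2 (derivable_uptoW dg).
Qed.

(** * Constancy on balls and antiderivatives *)

Lemma derive0_cst_ball [c r : R] [f] :
  (forall y, ball c r y -> is_derive y 1 f 0) ->
  forall y z, ball c r y -> ball c r z -> f y = f z.
Proof.
move=> df; suff lem y z : ball c r y -> ball c r z -> y <= z -> f y = f z.
  by move=> y z ? ?; case: (leP y z) => [|/ltW] ?; [|symmetry]; exact: lem.
rewrite ball_itv /= !in_itv /= => /andP[cy yc] /andP[cz zc] yz.
have yzB x : x \in `[y, z] -> ball c r x.
  rewrite ball_itv /= !in_itv /= => /andP[yx xz].
  by rewrite (lt_le_trans cy yx) (le_lt_trans xz zc).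
have [||x _] := @MVT_segment R f (fun=> 0) y z yz.
- by move=> x xyz; apply/df/yzB; exact: subset_itv_oo_cc xyz.
- by apply: derivable_within_continuous => x /yzB /df [].
by rewrite mul0r => /eqP; rewrite subr_eq0 => /eqP.
Qed.

Lemma antiderivative [U f y] : open U -> smooth_on U f -> U y ->
  exists (r : R) (F : R -> R),
    [/\ 0 < r, ball y r `<=` U &
        forall z, ball y r z -> is_derive z 1 F (f z)].
Proof.
move=> oU sf Uy.
have [r /= r0 rU] : exists2 r : R, 0 < r & closed_ball y r `<=` U.
  have /nbhs_ballP[r /= r0 rU] : nbhs y U by exact: open_nbhs_nbhs.
  (* Halving the radius puts the closed ball inside [U], so the integrand is continuous up to the
     endpoints. *)
  exists (r / 2); first by rewrite divr_gt0.
  by apply: subset_trans rU; exact: subset_closure_half.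
(* The integral starts at the left endpoint, which lies below every point of the ball. *)
exists r, (fun x => \int[lebesgue_measure]_(t in [set` `[y - r, x]]) f t)%R.
split=> //; first by apply: subset_trans rU; exact: subset_closed_ball.
move=> z; rewrite ball_itv /= in_itv /= => /andP[rz zr].
have [||||dF <-] := @continuous_FTC1_closed R f (y - r) z (y + r).
- by [].
- apply: continuous_compact_integrable; first exact: segment_compact.
  apply: continuous_in_subspaceT => x /set_mem xr.
  apply: smooth_continuous sf _; apply: rU.
  by rewrite closed_ball_itv.
- by [].
- apply: smooth_continuous sf _; apply: rU; rewrite closed_ball_itv //= in_itv /=.
  by rewrite !ltW.
exact: derivable_is_derive1.
Qed.

End smooth_functions.

(** * Smooth inverses and affine coordinates *)

Section diffeo.
Context {R : realType}.
Implicit Types (U W : set R) (f g : R -> R).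

Lemma derivable_uptoN [U n f] : open U ->
  derivable_upto U n f -> derivable_upto U n (\- f).
Proof.
move=> oU; elim: n f => [|n IHn] f df.
  by split=> // y Uy; apply: derivableN; exact: df.1.
apply: (@derivable_uptoS _ _ _ _ (\- derive1 f) oU); last exact: IHn df.2.
by move=> y Uy; apply: is_deriveN; exact: derivable_upto_is_derive df Uy.
Qed.

Lemma derivable_uptoV [U n f] : open U -> (forall y, U y -> f y != 0) ->
  derivable_upto U n f -> derivable_upto U n (fun y => (f y)^-1).
Proof.
move=> oU f0; elim: n => [|n IHn] df.
  by split=> // y Uy; apply: derivableV; [exact: f0|exact: df.1].
have dV := IHn (derivable_uptoW df).
apply: (@derivable_uptoS _ _ _ _
  ((\- derive1 f) \* ((fun y => (f y)^-1) \* (fun y => (f y)^-1))) oU).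
  move=> y Uy.
  have := is_deriveV (f0 _ Uy) (derivable_upto_is_derive df Uy).
  by rewrite /GRing.scale /= mulNr mulrC -mulrN /= -exprVn expr2 mulNr mulrN.
apply: (derivable_uptoM oU (derivable_uptoN oU df.2)).
exact: (derivable_uptoM oU dV dV).
Qed.

(** The mean value theorem makes [f] strictly increasing, the intermediate value theorem makes its
    image open, and [g' = (1 / f') \o g] makes the inverse smooth. *)
Lemma derive1_gt0_diffeo_on (c r : R) f : smooth_on (ball c r) f ->
  (forall y, ball c r y -> 0 < derive1 f y) -> diffeo_on (ball c r) f.
Proof.
set W := ball c r => sf f'0.
have oW : open W by exact: ball_open.
have Wcc x z : W x -> W z -> forall y, y \in `[x, z] -> W y.
  rewrite /W ball_itv /= !in_itv /= => /andP[cx _] /andP[_ zc] y.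
  rewrite !in_itv /= => /andP[xy yz].
  by rewrite (lt_le_trans cx xy) (le_lt_trans yz zc).
have f_lt x z : W x -> W z -> x < z -> f x < f z.
  move=> Wx Wz xz.
  have [||y yxz /eqP] := @MVT_segment R f (derive1 f) x z (ltW xz).
  - move=> y yxz; apply: smooth_on_derive1 sf _.
    by apply: (Wcc _ _ Wx Wz); exact: subset_itv_oo_cc yxz.
  - by apply: derivable_within_continuous => y /(Wcc _ _ Wx Wz) /(sf 0%N).
  rewrite -subr_gt0 => /eqP ->; rewrite mulr_gt0 ?subr_gt0 //.
  exact/f'0/(Wcc _ _ Wx Wz).
have f_inj x z : W x -> W z -> f x = f z -> x = z.
  move=> Wx Wz fxz; case: (ltgtP x z) => // [/f_lt|/f_lt];
  by rewrite fxz ltxx => /(_ _ _)/negP; case.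
have oI : open (f @` W).
  rewrite openE => _ [x Wx <-]; rewrite /interior.
  have [e e0 eW] : exists2 e : R, 0 < e & closed_ball x e `<=` W.
    have /nbhs_ballP[e /= e0 eW] : nbhs x W by exact: open_nbhs_nbhs.
    exists (e / 2); first by rewrite divr_gt0.
    by apply: subset_trans eW; exact: subset_closure_half.
  rewrite closed_ball_itv // in eW.
  have We : W (x - e) /\ W (x + e).
    by split; apply: eW; rewrite /= in_itv /=; apply/andP; split; lra.
  case: We => Wl Wr.
  have fl : f (x - e) < f x by apply: f_lt => //; rewrite gtrBl.
  have fr : f x < f (x + e) by apply: f_lt => //; rewrite ltrDl.
  (* This interval is a neighbourhood of [f x] all of whose values are attained between [x - e] and
     [x + e]. *)
  have : f x \in `]f (x - e), f (x + e)[ by rewrite in_itv /= fl fr.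
  move=> /near_in_itvoo; apply: filterS => v; rewrite in_itv /= => /andP[lv vr].
  have [|||y yl <-] := @IVT R f (x - e) (x + e) v.
  - by lra.
  - by apply: derivable_within_continuous => y /eW /(sf 0%N).
  - by rewrite ge_min le_max (ltW lv) (ltW vr) orbT.
  by exists y => //; exact: eW.
(* The default [c] is taken only off the image of [W], where the inverse is irrelevant. *)
pose g z := xget c [set y | W y /\ f y = z].
have gK y : W y -> g (f y) = y.
  move=> Wy; rewrite /g; case: xgetP => [z _ [Wz /f_inj]|/(_ y)]; first exact.
  by case.
have g' y : W y -> is_derive (f y) 1 g (derive1 f y)^-1.
  move=> Wy; apply: is_derive_inverse.
  - by apply: filterS gK _; exact: open_nbhs_nbhs.
  - apply: (@filterS _ _ _ W); last exact: open_nbhs_nbhs.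
    by move=> z; exact: smooth_continuous sf.
  - exact: smooth_on_derive1 sf Wy.
  - by rewrite gt_eqF // f'0.
(* Bootstrap: differentiability of [g] to order [n] passes to [(1 / f') \o g], which is [g'], and so
   gives order [n.+1]. *)
split=> //; exists g => //; apply/smooth_onP; elim=> [|n IHn].
  by split=> // _ [y Wy <-]; have [] := g' y Wy.
apply: (@derivable_uptoS _ _ _ _ ((fun y => (derive1 f y)^-1) \o g) oI).
  by move=> _ [y Wy <-] /=; rewrite gK //; exact: g'.
apply: (@derivable_upto_comp _ _ W _ _ _ oI _ _ IHn).
  by move=> _ [y Wy <-]; rewrite gK.
apply: derivable_uptoV oW _ _; first by move=> y Wy; rewrite gt_eqF // f'0.
by move/smooth_onP : sf => /(_ n.+1) [].
Qed.

(* f' = exp F with F' = G. *)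
Lemma affine_coordinate [U] [G : R -> R] [y] :
  open U -> smooth_on U G -> U y -> exists (r : R) (f : R -> R),
    [/\ 0 < r, ball y r `<=` U, diffeo_on (ball y r) f &
        forall z, ball y r z ->
          0 < derive1 f z /\ derive1 (derive1 f) z = G z * derive1 f z].
Proof.
move=> oU sG Uy; have [r [F [r0 rU dF]]] := antiderivative oU sG Uy.
set W := ball y r.
have oW : open W by exact: ball_open.
have dE z : W z -> is_derive z 1 (expR \o F) (expR (F z) * G z).
  by move=> Wz; apply: is_derive1_comp; exact: dF.
(* Since [(exp F)' = exp F * G] with [G] smooth, each order of differentiability of [exp F] yields
   the next. *)
have sE : smooth_on W (expR \o F).
  apply/smooth_onP; elim=> [|n IHn].
    by split=> // z Wz; have [] := dE z Wz.
  have /smooth_onP sWG : smooth_on W G by move=> k z /rU; exact: sG.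
  by apply: derivable_uptoS dE _ => //; exact: derivable_uptoM.
have Wy : W y by exact: ballxx.
(* A second integration, on a possibly smaller ball, gives [f] with [f' = exp F > 0]. *)
have [s [f [s0 sW df]]] := antiderivative oW sE Wy.
have f'E z : ball y s z -> derive1 f z = expR (F z).
  by move=> /df Dz; rewrite derive1E derive_val.
exists s, f; split=> //; first exact: subset_trans rU.
  have /smooth_onP sEs : smooth_on (ball y s) (expR \o F).
    by move=> k z /sW; exact: sE.
  apply: derive1_gt0_diffeo_on.
    apply/smooth_onP => -[|n]; first by split=> // z /df [].
    by apply: derivable_uptoS df _; first exact: ball_open.
  by move=> z /f'E ->; exact: expR_gt0.
move=> z sz; rewrite f'E //; split; first exact: expR_gt0.
rewrite derive1E (@near_eq_derive _ _ _ _ (expR \o F)); last first.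
  by apply: near_open_eq sz => //; exact: ball_open.
by have [_ ->] := dE z (sW _ sz); rewrite mulrC.
Qed.

End diffeo.

(** * Unique continuation for the second determining equation *)

Section determining.
Context {R : realType}.

(* Once the constant [eta' + G eta] vanishes, [exp F * eta] is constant too. *)
Lemma determining_unique [U : set R] [A G eta F : R -> R] [c r : R] :
  open U -> smooth_on U G -> smooth_on U eta ->
  (forall y, U y -> determining_equations A G eta y) ->
  ball c r `<=` U -> (forall y, ball c r y -> is_derive y 1 F (G y)) ->
  forall z, ball c r z -> (\near z, eta z = 0) ->
  forall y, ball c r y -> eta y = 0.
Proof.
move=> oU sG se det BU dF z Bz e0 y By.
have ez : eta z = 0 := nbhs_singleton e0.
have e'z : derive1 eta z = 0.
  by rewrite derive1E (near_eq_derive _ e0) derive_cst.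
(* Moving [eta' G] to the other side, the second determining equation reads
   [eta'' + G eta' + G' eta = 0], that is [(eta' + G eta)' = 0]. *)
have dk x : ball c r x -> is_derive x 1 (derive1 eta \+ G \* eta) 0.
  move=> /BU Ux; have [_ detx] := det x Ux.
  have -> : 0 = derive1 (derive1 eta) x +
      (G x *: derive1 eta x + eta x *: derive1 G x).
    by rewrite /GRing.scale /=; lra.
  apply: is_deriveD; first exact: smooth_on_derive2 se Ux.
  by apply: is_deriveM; apply: smooth_on_derive1 Ux.
have k0 x : ball c r x -> derive1 eta x + G x * eta x = 0.
  move=> Bx; rewrite (derive0_cst_ball dk _ _ Bx Bz : _ + _ = _) /=.
  by rewrite ez e'z mulr0 addr0.
(* [exp F] is an integrating factor: [(exp F * eta)' = exp F * (eta' + G eta)]. *)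
have dm x : ball c r x -> is_derive x 1 ((expR \o F) \* eta) 0.
  move=> Bx.
  have -> : 0 = expR (F x) *: derive1 eta x + eta x *: (expR (F x) * G x).
    by rewrite /GRing.scale /= mulrCA -mulrDr [eta x * _]mulrC k0 // mulr0.
  apply: is_deriveM; last exact: smooth_on_derive1 se (BU _ Bx).
  by apply: is_derive1_comp; exact: dF.
have /eqP := derive0_cst_ball dm _ _ By Bz.
by rewrite /= ez mulr0 mulf_eq0 gt_eqF ?expR_gt0 //= => /eqP.
Qed.

End determining.

(** * Propagation of zeros of a symmetry over the manifold *)

Section manifold.
Context {R : realType} {M : manifold1 R}.

Lemma mcoord_continuous [i : mindex M] [p : mpoint M] : mdom i p ->
  {for p, continuous (mcoord i)}.
Proof.
move=> ip; have := @m_coord_continuous R M i.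
by rewrite (continuous_open_subspace _ (m_dom_open i)); apply; exact/mem_set.
Qed.

Lemma minv_continuous [i : mindex M] [p : mpoint M] : mdom i p ->
  {for mcoord i p, continuous (minv i)}.
Proof.
move=> ip; have := @m_inv_continuous R M i.
rewrite (continuous_open_subspace _ (@m_image_open R M i)); apply.
by apply/mem_set; exists p.
Qed.

Lemma point_symmetry_eq0 [A : mpoint M -> R] [Gam eta : mindex M -> R -> R] :
  connected [set: mpoint M] -> smooth_operator_field A ->
  affine_connection Gam -> point_symmetries A Gam eta ->
  forall i p, mdom i p ->
    derive1 (operator_component A i) (mcoord i p) != 0 ->
  forall j y, eta j y = 0.
Proof.
move=> connM sA [sGam _] [[seta eta0 etaT] det] i p ip A'0.
pose vanish := [set q | forall j, mdom j q -> eta j (mcoord j q) = 0].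
(* By the transformation law of vector fields, vanishing in one chart gives vanishing in all. *)
have vanishI j q : mdom j q -> eta j (mcoord j q) = 0 -> vanish q.
  by move=> jq e0 k kq; rewrite (etaT j k q jq kq) e0 mulr0.
have image (j : mindex M) (q : mpoint M) :
    mdom j q -> chart_image j (mcoord j q) by move=> ?; exists q.
have near_dom (j : mindex M) (q : mpoint M) : mdom j q -> nbhs q (mdom j).
  by move=> jq; apply: open_nbhs_nbhs; split => //; exact: m_dom_open.
(* [A'] stays nonzero near [p] by continuity, so the first determining equation forces [eta = 0]
   there. *)
have Zp : (vanish°) p.
  have A'n0 :
      \forall y \near mcoord i p, derive1 (operator_component A i) y != 0.
    have [dA' _] := smooth_on_derive2 (sA i) (image _ _ ip).
    have cA' := differentiable_continuous ((derivable1_diffP _ _).1 dA').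
    exact: cvgr_neq0 cA' A'0.
  apply: filterS2 (near_dom _ _ ip) (mcoord_continuous ip _ A'n0).
  move=> q iq /= A'q; apply: (vanishI i q iq).
  have [/eqP + _] := det i _ (image _ _ iq).
  by rewrite mulf_eq0 (negbTE A'q) orbF => /eqP.
(* A chart ball around a limit point [q] meets the interior at some [z]; unique continuation carries
   the zeros near [z] to the whole ball, hence to a neighbourhood of [q]. *)
have Zclosed : closed (vanish°).
  move=> q Zq; have [j jq] := m_cover q.
  have oU : open (chart_image j) := @m_image_open R M j.
  have [r [F [r0 rU dF]]] := antiderivative oU (sGam j) (image _ _ jq).
  have nB : nbhs q (mdom j `&` mcoord j @^-1` ball (mcoord j q) r).
    apply: filterI; first exact: near_dom.
    apply: (mcoord_continuous jq); exact: nbhsx_ballx.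
  have [z [Zz [jz Bz]]] := Zq _ nB.
  have e0 : \forall y \near mcoord j z, eta j y = 0.
    have nZ : nbhs (minv j (mcoord j z)) vanish by rewrite m_coordK.
    apply: filterS2 (open_nbhs_nbhs (conj oU (image _ _ jz)))
      (minv_continuous jz _ nZ).
    by move=> _ [s js <-]; rewrite /= m_coordK //; exact.
  have eB := determining_unique oU (sGam j) (seta j) (det j) rU dF _ Bz e0.
  apply: filterS nB => s [js /eB]; exact: vanishI.
have ZT : vanish° = setT.
  apply: (connM _ (ex_intro _ p Zp)).
    by exists (vanish°); [exact: open_interior|rewrite setTI].
  by exists (vanish°); rewrite ?setTI.
(* Outside the chart image the component is zero by normalisation. *)
move=> j y; have [[q jq <-]|/eta0->//] := pselect (chart_image j y).
have /interior_subset : (vanish°) q by rewrite ZT.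
exact.
Qed.

End manifold.

(** * Transport of solutions by a point transformation *)

Section maps_solutions.
Context {R : realType}.
Implicit Types (D : set (R * R)) (u v : R -> R -> R) (f : R -> R).

(** The regularity half of [solves], kept apart from the equation so that it can be transported by
    [f] and by its inverse. *)
Definition has_jet D u := forall x t, D (x, t) ->
  [/\ derivable (u x) t 1, derivable (u^~ t) x 1 &
      derivable (derive1 (u^~ t)) x 1].

Lemma open_slices [D x t] : open D -> D (x, t) ->
  (\forall y \near x, D (y, t)) /\ (\forall s \near t, D (x, s)).
Proof.
move=> oD Dxt; have [[P Q] /= [nP nQ] PQ] : nbhs (x, t) D.
  exact: open_nbhs_nbhs.
by split; [apply: filterS nP|apply: filterS nQ] => z ?; apply: PQ;
  split=> //; exact: nbhs_singleton.
Qed.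

Lemma has_jet_eq [D u v] : open D -> (forall x t, D (x, t) -> u x t = v x t) ->
  has_jet D u -> has_jet D v.
Proof.
move=> oD uv ju x t Dxt; have [ut ux uxx] := ju x t Dxt.
have [Dx Dt] := open_slices oD Dxt.
split.
- by apply: near_eq_derivable ut; apply: filterS Dt => s /uv.
- by apply: near_eq_derivable ux; apply: filterS Dx => s /uv.
- apply: near_eq_derivable uxx; apply: filterS Dx => y Dy.
  rewrite !derive1E; apply: near_eq_derive.
  by apply: filterS (open_slices oD Dy).1 => z /uv.
Qed.

Lemma is_derive_comp_jet [D W f u] : open D -> smooth_on W f ->
  (forall x t, D (x, t) -> W (u x t)) -> has_jet D u ->
  forall x t, D (x, t) ->
  [/\ is_derive t 1 (fun t => f (u x t)) (derive1 f (u x t) * derive1 (u x) t),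
      is_derive x 1 (fun x => f (u x t))
        (derive1 f (u x t) * derive1 (u^~ t) x) &
      is_derive x 1 (derive1 (fun x => f (u x t)))
        (derive1 f (u x t) * derive1 (derive1 (u^~ t)) x +
         derive1 (derive1 f) (u x t) * derive1 (u^~ t) x ^+ 2)].
Proof.
move=> oD sf DW ju x t Dxt.
have Dux y : D (y, t) -> is_derive y 1 (u^~ t) (derive1 (u^~ t) y).
  by move=> Dy; apply: derivable_is_derive1; case: (ju y t Dy).
have Dfux y : D (y, t) -> is_derive y 1 (fun x => f (u x t))
    (derive1 f (u y t) * derive1 (u^~ t) y).
  move=> Dy; apply: (@is_derive1_comp R f (u^~ t) y); last exact: Dux.
  exact: smooth_on_derive1 sf (DW _ _ Dy).
have [Dx Dt] := open_slices oD Dxt.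
have [ut _ uxx] := ju x t Dxt.
split; last 1 first.
(* The first-order chain rule holds on the whole slice of [D] near [x], so it may be differentiated
   again. *)
- have near_fux : \near x, ((derive1 f \o u^~ t) \* derive1 (u^~ t)) x =
      derive1 (fun x => f (u x t)) x.
    apply: filterS Dx => y /Dfux [_ dE].
    by rewrite [RHS]derive1E dE.
  apply: near_eq_is_derive near_fux _.
  have -> : derive1 f (u x t) * derive1 (derive1 (u^~ t)) x +
      derive1 (derive1 f) (u x t) * derive1 (u^~ t) x ^+ 2 =
      derive1 f (u x t) *: derive1 (derive1 (u^~ t)) x +
      derive1 (u^~ t) x *:
        (derive1 (derive1 f) (u x t) * derive1 (u^~ t) x).
    by rewrite /GRing.scale /= expr2 mulrCA.
  apply: is_deriveM; last exact: derivable_is_derive1.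
  apply: (@is_derive1_comp R (derive1 f) (u^~ t) x); last exact: Dux.
  exact: smooth_on_derive2 sf (DW _ _ Dxt).
- apply: (@is_derive1_comp R f (u x) t); last exact: derivable_is_derive1.
  exact: smooth_on_derive1 sf (DW _ _ Dxt).
- exact: Dfux.
Qed.

Lemma has_jet_comp [D W f u] : open D -> smooth_on W f ->
  (forall x t, D (x, t) -> W (u x t)) -> has_jet D u ->
  has_jet D (fun x t => f (u x t)).
Proof.
move=> oD sf DW ju x t Dxt.
have [[ft _] [fx _] [fxx _]] := is_derive_comp_jet oD sf DW ju _ _ Dxt.
by split; [exact: ft|exact: fx|exact: fxx].
Qed.

(** Because [f'' = G f'], both sides of the new equation at [f u] are [f'(u)] times the sides of the
    old one at [u], and [f'(u)] is nonzero. *)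
Lemma maps_solutions_affine [W f] [A G : R -> R] [a : R] : diffeo_on W f ->
  (forall y, W y -> [/\ A y = a, 0 < derive1 f y &
    derive1 (derive1 f) y = G y * derive1 f y]) ->
  maps_solutions W f (evolution_rhs A G) (fun _ _ yxx => a * yxx).
Proof.
move=> [oW ofW sf [g sg gK]] AG D u oD DW.
have rhsE x t : D (x, t) -> has_jet D u ->
    [/\ derive1 (fun t => f (u x t)) t = derive1 f (u x t) * derive1 (u x) t &
    a * derive1 (derive1 (fun x => f (u x t))) x = derive1 f (u x t) *
      evolution_rhs A G (u x t) (derive1 (u^~ t) x)
        (derive1 (derive1 (u^~ t)) x)].
  move=> Dxt ju; have [Aa _ f''] := AG _ (DW _ _ Dxt).
  have [ft fx fxx] := is_derive_comp_jet oD sf DW ju _ _ Dxt.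
  split; first by rewrite derive1E derive_val.
  rewrite [in LHS]derive1E derive_val f'' /evolution_rhs Aa expr2.
  by ring.
split=> sol.
  have ju : has_jet D u by move=> x t /sol[].
  move=> x t Dxt; have [ft fx fxx] := has_jet_comp oD sf DW ju _ _ Dxt.
  split; [exact: ft|exact: fx|exact: fxx|].
  have [-> ->] := rhsE x t Dxt ju.
  by congr (_ * _); case: (sol _ _ Dxt).
have jv : has_jet D (fun x t => f (u x t)) by move=> x t /sol[].
(* The regularity of [u] is recovered from [u = g (f u)] with [g] smooth. *)
have ju : has_jet D u.
  apply: (has_jet_eq oD (fun x t Dxt => gK _ (DW x t Dxt))).
  apply: has_jet_comp oD sg _ jv => x t /DW Wu.
  by exists (u x t).
move=> x t Dxt; have [ut ux uxx] := ju _ _ Dxt.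
split; [exact: ut|exact: ux|exact: uxx|].
have [_ _ _ solE] := sol _ _ Dxt.
have [ftE fxxE] := rhsE x t Dxt ju; rewrite ftE fxxE in solE.
apply: mulfI solE; have [_ f'0 _] := AG _ (DW _ _ Dxt).
by rewrite gt_eqF.
Qed.

End maps_solutions.

(** * Constancy of [A] and the local normal form *)

Theorem theorem23p1 (R : realType) (M : manifold1 R)
    (M_connected : connected [set: mpoint M])
    (A : mpoint M -> R) (A_smooth : smooth_operator_field A)
    (A_neq0 : forall p, A p <> 0)
    (Gam : mindex M -> R -> R) (Gam_connection : affine_connection Gam)
    (dim_sym : has_dim (point_symmetries A Gam) 2) :
  forall (i : mindex M) (p : mpoint M), mdom i p ->
    exists (W : set R) (f : R -> R) (a : R),
      [/\ W (mcoord i p),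
          W `<=` chart_image i,
          diffeo_on W f,
          forall y, W y ->
            operator_component A i y = a /\
            connection_law f (Gam i) (fun=> 0) y &
          maps_solutions W f
            (evolution_rhs (operator_component A i) (Gam i))
            (fun _ _ yxx => a * yxx)].
Proof.
(* Otherwise the basis vector [e ord0] would vanish, and the coefficients [(1, 0)] would give a
   nontrivial linear relation. *)
have A'0 i p : mdom i p -> derive1 (operator_component A i) (mcoord i p) = 0.
  move=> ip; apply/eqP; apply: contraT => A'0.
  have [e [sym_e free_e _]] := dim_sym.
  have e0 : e ord0 = 0.
    apply/funext => j; apply/funext => y.
    exact: (point_symmetry_eq0 M_connected A_smooth Gam_connection (sym_e ord0)
      _ _ ip A'0).
  have c0 : \sum_(k < 2) (k == ord0)%:R *: e k = 0.
    by rewrite big_ord_recl e0 scaler0 add0r big1 // => k _; rewrite scale0r.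
  by have /eqP := free_e _ c0 ord0; rewrite eqxx oner_eq0.
move=> i p ip; set y := mcoord i p.
have oU : open (chart_image i) := @m_image_open R M i.
have Uy : chart_image i y by exists p.
have [sG _] := Gam_connection.
have [r [f [r0 rU df f'P]]] := affine_coordinate oU (sG i) Uy.
have Aa z : ball y r z -> operator_component A i z = operator_component A i y.
  move=> Bz; apply: (@derive0_cst_ball R y r) => //; last exact: ballxx.
  move=> x /rU [q iq <-]; rewrite -(A'0 i q iq).
  by apply: smooth_on_derive1 (A_smooth i) _; exists q.
exists (ball y r), f, (operator_component A i y); split=> //.
- exact: ballxx.
(* With zero target connection, the law reduces to [Gam i = f'' / f']. *)
- move=> z Bz; split; first exact: Aa.
  have [f'0 f''E] := f'P z Bz.
  by rewrite /connection_law mul0r add0r f''E mulfK // gt_eqF.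
- apply: maps_solutions_affine => // z Bz.
  by have [? ?] := f'P z Bz; split => //; exact: Aa.
Qed.
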